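(* Let $S$ be the set containing 6 copies of each even positive integer that is not a multiple of 5, and let $T$ be the set containing 6 copies of each odd positive integer that is not a multiple of 5. Let $D_S(N)$ (respectively, $D_T(N)$) be the number of partitions of $N$ into an odd number of distinct elements of $S$ (respectively, $T$). Then, for every integer $N\geq 4$, $$D_S(N)=D_T(N-3).$$
   Context: A ''set containing several copies'' of certain integers means a set of colored integers: the different copies of the same integer are regarded as distinct (distinguishable) elements, each having that integer as its value. A partition of $N$ into distinct elements of $X$ is a finite subset of $X$ whose elements have values summing to $N$ (so each copy is used at most once, but different copies of the same integer may be used together, and subsets using different copies are counted as different); the number of parts is the cardinality of this subset. *)

(* Defs.v *)
From mathcomp Require Import all_boot finmap.
From mathcomp Require Import boolp classical_sets cardinality.

Set Implicit Arguments.
Unset Strict Implicit.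
Unset Printing Implicit Defensive.

Local Open Scope nat_scope.
Local Open Scope classical_set_scope.

(* [(n, c)] is the copy of the integer [n] bearing the color [c]. *)
Definition colored_int : choiceType := (nat * 'I_6)%type.

Definition value (x : colored_int) : nat := x.1.

Definition S_parts : set colored_int :=
  [set x : colored_int | [/\ 0 < value x, ~~ odd (value x) & ~~ (5 %| value x)]].

Definition T_parts : set colored_int :=
  [set x : colored_int | [/\ 0 < value x, odd (value x) & ~~ (5 %| value x)]].

Definition distinct_partitions (X : set colored_int) (N : nat) :
    set {fset colored_int} :=
  [set A : {fset colored_int} |
    (forall x, x \in A -> X x) /\ \sum_(x <- A) value x = N].

Definition odd_distinct_partitions (X : set colored_int) (N : nat) :
    set {fset colored_int} :=
  [set A : {fset colored_int} | distinct_partitions X N A /\ odd #|` A|].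

(* [fset_set] returns the empty set on infinite sets; this default
   value never occurs here, by [finite_odd_distinct_partitions]. *)
Definition odd_partition_count (X : set colored_int) (N : nat) : nat :=
  #|` fset_set (odd_distinct_partitions X N)|.

Definition D_S (N : nat) : nat := odd_partition_count S_parts N.

Definition D_T (N : nat) : nat := odd_partition_count T_parts N.

Lemma finite_odd_distinct_partitions (X : set colored_int) (N : nat) :
  finite_set (odd_distinct_partitions X N).
Proof.
pose f (i : 'I_N.+1 * 'I_6) : colored_int := (val i.1, i.2).
pose B : {fset colored_int} := [fset x in codom f]%fset.
apply: (@sub_finite_set _ _ [set` fpowerset B]); last exact: finite_fset.
move=> A [[AX sumA] _] /=.
rewrite fpowersetE; apply/fsubsetP => -[i c] iA.
have iN : i < N.+1.
  by rewrite ltnS -sumA (big_fsetD1 (i, c)) //= leq_addr.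
by rewrite inE; apply/codomP; exists (Ordinal iN, c).
Qed.

(* Main.v *)
Require Import Defs.
From mathcomp Require Import all_boot all_algebra all_field finmap.
From mathcomp Require Import boolp classical_sets cardinality zify ring.

Set Implicit Arguments.
Unset Strict Implicit.
Unset Printing Implicit Defensive.

Import GRing.Theory Num.Theory.
Local Open Scope ring_scope.

(** Write [u], [v], [w] and [beta] for the products of [1 + q^k] over odd [k],
    of [1 - q^k] over odd [k], of [1 + q^k] over even [k] and of [1 - q^k] over
    even [k], where [k] runs over the positive integers prime to 5.  Selecting
    the odd subsets by a sign, the theorem says that the power series
      [w^6 - beta^6 - q^3 (u^6 - v^6)]
    has no coefficient in degree 4 or more; it is in fact equal to [12 q^2].

    The reason is that, with [b = beta^2], the three series
      [U = q u^2],  [V = - q v^2],  [W = - w^2]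
    are the three roots of the single cubic
      [b T^3 + b^2 T^2 - 5 q^2 T - b q^2 = 0].
    By Vieta [U + V + W = - b], and Newton's formula gives
    [U^3 + V^3 + W^3 = - b^3 - 12 q^2], which is the identity
    ([cubic_power_sum], [eta_identity]).

    The cubic comes from the factorization [5 = (2 + i)(2 - i)] in the Gaussian
    integers.  Let [F] be the theta series of [Z] or of its translate by 1/2.
    Then [F^2] is a sum over Gaussian integers (or a translate), and the part
    [Z0] of that sum supported on the ideal generated by [2 - i] is, up to a
    power of [q], the square of the same theta series at [q^5].  The other four
    cosets of the ideal are exchanged by the rotation [i], which computes
    [F^2 - Z0] ([theta_sqr_split]); the characters of the quotient, which has
    order 5, compute [5 Z0 - F^2] by means of theta series twisted by fifth
    roots of unity ([theta_root_sum]).  Jacobi's triple product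
    ([jacobi_triple]) turns all these series into products, and dividing one
    identity by the other leaves the cubic ([odd_cubic], [even_cubic]).  The
    root [V] is obtained from [U] by changing [q] into [- q].

    Power series are handled modulo [q^M]: every identity is proved in a
    commutative ring in which [q^M = 0], so that all sums and products are
    finite.  The ring used at the end is that of polynomials over the algebraic
    numbers modulo a power of the indeterminate. *)

(** * Sums of terms that vanish outside a finite set *)

(** Sums over [Z] or [Z * Z] are represented by finite windows.  A bijection of
    the indices need not preserve the windows; it is enough that it matches the
    indices whose terms differ from [idx]. *)
Lemma reindex_supp (R : eqType) (idx : R) (op : Monoid.com_law idx)
    (I J : eqType) (r : seq I) (s : seq J) (P : pred J) (h : I -> J)
    (F : J -> R) :
  uniq r -> uniq s -> injective h ->
  (forall i, i \in r -> F (h i) != idx -> (h i \in s) && P (h i)) ->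
  (forall j, j \in s -> P j -> F j != idx -> exists2 i, i \in r & h i = j) ->
  \big[op/idx]_(j <- s | P j) F j = \big[op/idx]_(i <- r) F (h i).
Proof.
move=> ur us hI Hr Hs.
have nz (K : Type) (x : seq K) (Q : pred K) (f : K -> R) :
    \big[op/idx]_(k <- x | Q k) f k =
    \big[op/idx]_(k <- x | Q k && (f k != idx)) f k.
  rewrite (bigID (fun k => f k == idx)) /= big1 ?Monoid.mul1m //.
  by move=> k /andP[_ /eqP].
rewrite [LHS]nz [RHS]nz /= -[LHS]big_filter -[RHS]big_filter.
rewrite -(big_map h predT F); apply: perm_big; apply: uniq_perm.
- exact: filter_uniq.
- by rewrite map_inj_uniq // filter_uniq.
move=> j; rewrite mem_filter; apply/idP/mapP.
  case/andP=> /andP[Pj Fj] js; have [i ir hij] := Hs j js Pj Fj.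
  by exists i => //; rewrite mem_filter hij Fj.
case=> i; rewrite mem_filter => /andP[Fi ir] ->.
by have /andP[-> ->] := Hr i ir Fi; rewrite Fi.
Qed.

(** * Jacobi's triple product *)

Section Jacobi.
Variable R : comNzRingType.
Implicit Types a b t : R.

Lemma expr_nil_geq t M n : t ^+ M = 0 -> (M <= n)%N -> t ^+ n = 0.
Proof. by move=> tM le; rewrite -(subnK le) exprD tM mulr0. Qed.

(** The quotient of Euler's product by its first [j] factors: it plays the role
    of [(t; t)_oo / (t; t)_j], without any division. *)
Definition euler_tail t M j := \prod_(j <= i < M) (1 - t ^+ i.+1).

Lemma euler_tailS t M j : t ^+ M = 0 ->
  euler_tail t M j = (1 - t ^+ j.+1) * euler_tail t M j.+1.
Proof.
move=> tM; rewrite /euler_tail; case: (ltnP j M) => jM; first by rewrite big_ltn.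
by rewrite !big_geq ?(leqW jM) // (expr_nil_geq tM (leqW jM)) subr0 mulr1.
Qed.

(** Euler's expansion of [(-a; t)_oo] in powers of [a], multiplied by Euler's
    product.  Downward induction on [m]: for [m = M] only the term [j = 0]
    survives, and the factor [1 + a t^m] acts on the coefficients by
    [euler_tailS]. *)
Lemma euler_sum a t M m : t ^+ M = 0 -> (m <= M)%N ->
  euler_tail t M 0 * \prod_(m <= i < M) (1 + a * t ^+ i) =
  \sum_(j < M.+2) euler_tail t M j * a ^+ j * t ^+ ('C(j, 2) + m * j).
Proof.
move=> tM; move mk: (M - m)%N => k; elim: k m mk => [|k IH] m mk mM.
  have -> : m = M by lia.
  rewrite big_geq // big_ord_recl /= big1 ?addr0 ?muln0 ?expr0 ?mulr1 // => j _.
  by rewrite /= (expr_nil_geq tM) ?mulr0 // /bump /=; nia.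
rewrite big_ltn; last by lia.
rewrite mulrCA IH; [|lia|lia].
rewrite mulrDl mul1r big_distrr /=.
have -> : \sum_(j < M.+2) euler_tail t M j * a ^+ j * t ^+ ('C(j, 2) + m * j) =
   euler_tail t M 0 + \sum_(j < M.+1)
     euler_tail t M j.+1 * a ^+ j.+1 * t ^+ ('C(j.+1, 2) + m * j.+1).
  by rewrite big_ord_recl /= muln0 !expr0 !mulr1.
rewrite big_ord_recl /= muln0 !expr0 !mulr1 -addrA; congr (_ + _).
rewrite [X in _ + X]big_ord_recr /=.
have -> : 'C(M.+1, 2) = ('C(M, 2) + M)%N by rewrite binS bin1 addnC.
have -> : t ^+ ('C(M, 2) + M + m.+1 * M.+1) = 0 by apply: (expr_nil_geq tM); nia.
rewrite !mulr0 addr0 -big_split /=; apply: eq_bigr => j _.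
rewrite /bump /= add1n (euler_tailS j tM) binS bin1.
rewrite !exprD !mulnS !mulSn !exprD !exprS; ring.
Qed.

(** Ramanujan's [a^(j(j+1)/2) b^(j(j-1)/2)]; both exponents are natural numbers
    for every integer [j], so no inverse of [a] or [b] is involved. *)
Definition theta_term a b (j : int) : R :=
  match j with
  | Posz n => a ^+ n * (a * b) ^+ 'C(n, 2)
  | Negz n => b ^+ n.+1 * (a * b) ^+ 'C(n.+1, 2)
  end.

Arguments theta_term : simpl never.

Lemma theta_term_Posz a b n :
  theta_term a b (Posz n) = a ^+ n * (a * b) ^+ 'C(n, 2).
Proof. by []. Qed.

Lemma theta_term_Negz a b n :
  theta_term a b (Negz n) = b * (a * b) ^+ n * theta_term a b (- n%:Z).
Proof.
case: n => [|n]; first by rewrite /theta_term /= expr0 expr1 !mulr1.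
rewrite (_ : - n.+1%:Z = Negz n) // /theta_term [in LHS]binS bin1 exprD exprS.
ring.
Qed.

Lemma theta_term_shift a b (k n : nat) :
  b * (a * b) ^+ n * theta_term a b (k.+1%:Z - n%:Z) =
  (a * b) ^+ k.+1 * theta_term a b (k%:Z - n%:Z).
Proof.
case: (ltnP k n) => kn.
  have [d ->] : exists d, n = (k + d.+1)%N by exists (n - k).-1; lia.
  have -> : k%:Z - (k + d.+1)%N%:Z = Negz d by lia.
  case: d => [|d].
    have -> : k.+1%:Z - (k + 1)%N%:Z = Posz 0 by lia.
    by rewrite /theta_term addn1 !expr0 expr1 !mulr1 mulrC.
  have -> : k.+1%:Z - (k + d.+2)%N%:Z = Negz d by lia.
  rewrite /theta_term [in RHS]binS bin1 !exprD.
  have -> : (a * b) ^+ d.+2 = (a*b) * (a*b) ^+ d.+1 by rewrite exprS.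
  rewrite [b ^+ d.+2]exprS [(a*b)^+ k.+1]exprS; ring.
have [d ->] : exists d, k = (n + d)%N by exists (k - n)%N; lia.
have -> : (n + d).+1%:Z - n%:Z = Posz d.+1 by lia.
have -> : (n + d)%N%:Z - n%:Z = Posz d by lia.
rewrite /theta_term binS bin1 -addnS !exprD !exprS; ring.
Qed.

(** One of the two infinite products is already complete, the other one has [n]
    factors.  Multiplying by [1 + b t^n] shifts the index of the theta terms by
    one, by [theta_term_shift], and turns [euler_tail k.+1] into
    [euler_tail k]; the case [n = 0] is [euler_sum]. *)
Lemma jacobi_aux a b M n K : (a * b) ^+ M = 0 -> (n + M.+2 <= K)%N ->
  euler_tail (a * b) M 0 * \prod_(0 <= i < M) (1 + a * (a * b) ^+ i)
    * \prod_(0 <= i < n) (1 + b * (a * b) ^+ i) =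
  \sum_(k < K) euler_tail (a * b) M k * theta_term a b (k%:Z - n%:Z).
Proof.
set t := a * b => tM; elim: n K => [|n IH] K nK.
  rewrite [X in _ * X]big_geq // mulr1 euler_sum // add0n in nK *.
  rewrite -(subnKC nK) big_split_ord /= [X in _ = _ + X]big1 ?addr0.
    by apply: eq_bigr => j _; rewrite mul0n addn0 subr0 theta_term_Posz -/t !mulrA.
  move=> j _; rewrite subr0 theta_term_Posz -/t (expr_nil_geq tM) ?mulr0 //=.
  have -> : (M.+2 + j = (M + j).+2)%N by lia.
  by rewrite binS bin1 ; lia.
rewrite [X in _ * X]big_nat_recr //= [LHS]mulrA.
case: K nK => [|K] nK; first by lia.
rewrite mulrDr mulr1 {1}(IH K); last by lia.
rewrite (IH K.+1); last by lia.
rewrite mulr_suml [X in _ + X]big_ord_recl [RHS]big_ord_recl addrCA -big_split /=.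
congr (_ + _).
  rewrite -[LHS]/(_ * theta_term a b (0 - n%:Z) * _) sub0r.
  rewrite -[RHS]/(_ * theta_term a b (0 - n.+1%:Z)) sub0r.
  rewrite -[- n.+1%:Z]/(Negz n) theta_term_Negz -/t; ring.
apply: eq_bigr => k _; rewrite /bump /= add1n (euler_tailS k tM).
have -> : k.+1%:Z - n.+1%:Z = k%:Z - n%:Z by lia.
have := theta_term_shift a b k n; rewrite -/t => e.
rewrite -[_ * theta_term a b (k.+1%:Z - n%:Z) * _]mulrA.
rewrite [theta_term a b (k.+1%:Z - n%:Z) * _]mulrC e; ring.
Qed.

Definition window (n : nat) : seq int := [seq i%:Z - n%:Z | i <- iota 0 n.*2.+1].

Lemma mem_window n j : (j \in window n) = (`|j| <= n)%N.
Proof.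
apply/mapP/idP => [[i]|jn]; first by rewrite mem_iota => /andP[_ /= h] ->; lia.
by exists (absz (j + n%:Z)); rewrite ?mem_iota; lia.
Qed.

Lemma window_uniq n : uniq (window n).
Proof. by rewrite map_inj_uniq ?iota_uniq // => i j; lia. Qed.

(** If [t^(k+1)] kills [x], then so does every later power of [t], hence each
    factor of [euler_tail] fixes [x]. *)
Lemma euler_tail_mul t M k x : t ^+ k.+1 * x = 0 -> euler_tail t M k * x = x.
Proof.
move=> tx; rewrite /euler_tail; elim: M => [|M IH]; first by rewrite big_geq ?mul1r.
case: (leqP k M) => kM; last by rewrite big_geq ?mul1r.
rewrite big_nat_recr // -mulrA mulrBl mul1r /=.
rewrite (_ : M.+1 = (M - k + k.+1)%N); last by lia.
by rewrite exprD -[_ * x]mulrA tx mulr0 subr0.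
Qed.

(** For [n = M] the coefficients [euler_tail] in [jacobi_aux] may be replaced by
    1: each differs from 1 by a multiple of a power of [a * b] that kills the
    theta term it multiplies. *)
Lemma jacobi_triple a b M : (a * b) ^+ M = 0 ->
  \sum_(j <- window M) theta_term a b j =
  \prod_(i < M) ((1 + a * (a * b) ^+ i) * (1 + b * (a * b) ^+ i)
                   * (1 - (a * b) ^+ i.+1)).
Proof.
move=> tM; rewrite !big_split /= mulrC mulrA.
have := @jacobi_aux a b M M (M.*2.+1 + M.+2) tM ltac:(lia).
rewrite {1}/euler_tail !big_mkord => ->.
rewrite big_split_ord /= [X in _ = _ + X]big1 ?addr0; last first.
  move=> i _; have -> : (M.*2.+1 + i)%N%:Z - M%:Z = Posz (M + i).+1 by lia.
  by rewrite theta_term_Posz (expr_nil_geq tM) ?mulr0 // binS bin1; lia.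
rewrite big_map -(big_mkord predT
  (fun k => euler_tail (a * b) M k * theta_term a b (k%:Z - M%:Z))).
rewrite /index_iota subn0; apply: eq_bigr => k _; rewrite euler_tail_mul //.
case: (ltnP k M) => kM; last by rewrite (expr_nil_geq tM) ?mul0r // leqW.
have -> : k%:Z - M%:Z = Negz (M - k).-1 by lia.
rewrite /theta_term mulrCA -exprD (expr_nil_geq tM) ?mulr0 // prednK; last by lia.
have [d ->] : exists d, M = (k + d.+1)%N by exists (M - k).-1; lia.
by rewrite addKn binS bin1; lia.
Qed.
End Jacobi.

(** * Theta series and products over arithmetic progressions *)

(** All products below become products over [k < M] of factors chosen according
    to [k %% 10]; their equalities are then checked class by class. *)
Ltac by_residue_mod10 k :=
  move: (1 + _) => ?;
  case: (posnP k) => [->|?]; first (by rewrite /= ?mulr1 ?mul1r);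
  let r := fresh "r" in let E := fresh "E" in
  (have : (k %% 10 < 10)%N by rewrite ltn_mod);
  move E: (k %% 10)%N => r;
  case: r E => [|[|[|[|[|[|[|[|[|[|//]]]]]]]]]] E _;
  do ![rewrite (_ : (_ <= _)%N && _ = true) /=; last by lia
     | rewrite (_ : (_ <= _)%N && _ = false) /=; last by lia];
  rewrite ?mulr1 ?mul1r //; try (case: ifP => //; lia).

Section Theta.
Variables (R : comNzRingType) (M : nat).
Implicit Types q c : R.

(** The sum of [c^j q^(A j^2 + B j)] over the integers.  The exponent of [c] is
    reduced modulo 5, [c] being always a fifth root of unity; with [B <= A] the
    exponent of [q] is natural. *)
Definition theta q (A B : nat) c : R :=
  \sum_(j <- window M)
    c ^+ absz (j %% 5)%Z * q ^+ absz (A%:Z * j ^+ 2 + B%:Z * j).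

Definition progprod q (d r : nat) c : R :=
  \prod_(i < M) (1 + c * q ^+ (d * i + r)).

Lemma expr5_mod c m n : c ^+ 5 = 1 -> m = n %[mod 5] -> c ^+ m = c ^+ n.
Proof. by move=> c5 e; rewrite -(expr_mod m c5) e expr_mod. Qed.

Lemma binomial2 n : (2 * 'C(n, 2) + n = n * n)%N.
Proof. by elim: n => // n IH; rewrite binS bin1; lia. Qed.

Lemma theta_product q A B c :
  q ^+ M = 0 -> (0 < A)%N -> (B <= A)%N -> c ^+ 5 = 1 ->
  theta q A B c = progprod q A.*2 (A + B) c * progprod q A.*2 (A - B) (c ^+ 4)
                  * progprod q A.*2 A.*2 (-1).
Proof.
move=> qM A0 BA c5; pose a := c * q ^+ (A + B); pose b := c ^+ 4 * q ^+ (A - B).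
have ab : a * b = q ^+ A.*2.
  rewrite /a /b mulrACA -exprS c5 mul1r -exprD; congr (_ ^+ _); lia.
have tM : (a * b) ^+ M = 0 by rewrite ab -exprM (expr_nil_geq qM) //; nia.
transitivity (\sum_(j <- window M) theta_term a b j).
  apply: eq_bigr => -[n|n] _.
    rewrite theta_term_Posz ab /a exprMn -mulrA -!exprM -exprD; congr (_ * _).
      by apply: expr5_mod => //; lia.
    by congr (_ ^+ _); have := binomial2 n; nia.
  rewrite /theta_term ab /b exprMn -mulrA -!exprM -exprD; congr (_ * _).
    by apply: expr5_mod => //; lia.
  by congr (_ ^+ _); have := binomial2 n.+1; rewrite NegzE; nia.
rewrite jacobi_triple // /progprod -!big_split /=; apply: eq_bigr => i _.
rewrite ab /a /b -!exprM -!mulrA -!exprD mulN1r.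
by rewrite mulnS ![(_ + _ * i)%N]addnC.
Qed.

Lemma progprod_split q d r c : q ^+ M = 0 -> (0 < d)%N ->
  progprod q d r c = \prod_(k < M)
    (if (r <= k)%N && (k == r %[mod d]) then 1 + c * q ^+ k else 1).
Proof.
move=> qM d0; rewrite -big_mkcond /= /progprod.
rewrite -(big_mkord (fun k => (r <= k)%N && (k == r %[mod d]))
                    (fun k => 1 + c * q ^+ k)).
rewrite -(big_mkord predT (fun i => 1 + c * q ^+ (d * i + r))).
symmetry; apply: (@reindex_supp _ _ _ _ _ _ _ _ (fun i => d * i + r)%N);
  rewrite ?iota_uniq //.
- by move=> i j; nia.
- move=> i _; rewrite leq_addl mulnC modnMDl eqxx andbT mem_index_iota /=.
  by case: ltnP => // Mk; rewrite (expr_nil_geq qM Mk) mulr0 addr0 eqxx.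
move=> k; rewrite mem_index_iota /= => kM /andP[rk].
rewrite eqn_mod_dvd // => /dvdnP[i ki] _; exists i; last by lia.
by rewrite mem_index_iota /=; nia.
Qed.

Lemma progprod_shift q d c : q ^+ M = 0 -> (0 < d)%N ->
  progprod q d 0 c = (1 + c) * progprod q d d c.
Proof.
move=> qM d0; rewrite /progprod; case: M qM => [|m] qM.
  by move: qM; rewrite expr0 => /eqP; rewrite oner_eq0.
rewrite big_ord_recl /= muln0 addn0 expr0 mulr1; congr (_ * _).
rewrite big_ord_recr /= (expr_nil_geq qM); last by nia.
rewrite mulr0 addr0 mulr1; apply: eq_bigr => i _.
by rewrite /bump /= add1n mulnSr addn0.
Qed.

Definition odd_prod q c :=
  progprod q 10 1 c * progprod q 10 3 c * progprod q 10 7 c * progprod q 10 9 c.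

Definition even_prod q c :=
  progprod q 10 2 c * progprod q 10 4 c * progprod q 10 6 c * progprod q 10 8 c.

Lemma progprod_odd q c : q ^+ M = 0 ->
  progprod q 2 1 c = odd_prod q c * progprod q 10 5 c.
Proof.
move=> qM; rewrite /odd_prod !progprod_split // -!big_split /=.
by apply: eq_bigr => k _; by_residue_mod10 (k : nat).
Qed.

Lemma progprod_even q c : q ^+ M = 0 ->
  progprod q 2 2 c = even_prod q c * progprod q 10 10 c.
Proof.
move=> qM; rewrite /even_prod !progprod_split // -!big_split /=.
by apply: eq_bigr => k _; by_residue_mod10 (k : nat).
Qed.
End Theta.

Section Units.
Variables (R : comUnitRingType) (M : nat).
Implicit Types q c : R.

Lemma unit_1Dnil (x : R) n : x ^+ n = 0 -> 1 + x \is a GRing.unit.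
Proof.
move=> xn; apply/unitrPr.
exists (\sum_(i < n) (- x) ^+ i).
have := subrX1 (- x) n; rewrite exprNn xn mulr0 sub0r => e.
by rewrite -[1 + x]opprK opprD addrC mulNr -e opprK.
Qed.

Lemma progprod_unit q d r c : q ^+ M = 0 -> (0 < r)%N ->
  progprod M q d r c \is a GRing.unit.
Proof.
move=> qM r0; apply: rpred_prod => i _; apply: (@unit_1Dnil _ M).
by rewrite exprMn -exprM (expr_nil_geq qM) ?mulr0 //; nia.
Qed.
End Units.

(** * Sums over the Gaussian integers *)

Section Lattice.
Variables (R : comNzRingType) (M : nat) (q : R).
Hypothesis qM : q ^+ M = 0.

Definition box : seq (int * int) := [seq (m, n) | m <- window M, n <- window M].

Lemma mem_box p : (p \in box) = (`|p.1| <= M)%N && (`|p.2| <= M)%N.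
Proof.
case: p => m n; rewrite -!mem_window; apply/allpairsP/idP => [[[a b] [/= aM bM [-> ->]]]|].
  by rewrite aM.
by case/andP=> mM nM; exists (m, n).
Qed.

Lemma box_uniq : uniq box.
Proof. by rewrite allpairs_uniq ?window_uniq // => -[a b] [c d]. Qed.

(** Change of variables between the sublattice (or coset) [P] and [Z * Z].  Terms
    with exponent at least [M] vanish, so the two boxes only have to contain
    the indices of smaller exponent. *)
Lemma lattice_sum (P : pred (int * int)) (h : int * int -> int * int)
    (E E' : int * int -> nat) :
  injective h -> (forall x, P (h x)) -> (forall p, P p -> exists x, h x = p) ->
  (forall x, E (h x) = E' x) ->
  (forall p, (E p < M)%N -> p \in box) -> (forall x, (E' x < M)%N -> x \in box) ->
  \sum_(p <- box | P p) q ^+ E p = \sum_(x <- box) q ^+ E' x.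
Proof.
move=> hI Ph hP EE' Eb E'b.
have small n : q ^+ n != 0 -> (n < M)%N.
  by apply: contraNT; rewrite -leqNgt => Mn; rewrite (expr_nil_geq qM Mn).
rewrite (@reindex_supp _ _ _ _ _ box box P h) ?box_uniq //.
- by apply: eq_bigr => x _; rewrite EE'.
- by move=> x _ /small Ex; rewrite Ph Eb.
move=> p _ /hP[x <-] /small Ex; exists x => //.
by rewrite E'b // -EE'.
Qed.

Lemma theta_mul A B A' B' c c' :
  theta M q A B c * theta M q A' B' c' =
  \sum_(p <- box) c ^+ absz (p.1 %% 5)%Z * c' ^+ absz (p.2 %% 5)%Z *
    (q ^+ absz (A%:Z * p.1 ^+ 2 + B%:Z * p.1) *
     q ^+ absz (A'%:Z * p.2 ^+ 2 + B'%:Z * p.2)).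
Proof.
rewrite /theta big_distrlr /= big_allpairs /=.
by apply: eq_bigr => m _; apply: eq_bigr => n _; rewrite mulrACA.
Qed.

(* The two cases [e = 0] and [e = 1] correspond to the lattice of Gaussian
   integers and to its translate by [(1 + i)/2]. *)
Variable e : nat.
Hypothesis e1 : (e <= 1)%N.

(** The norm of [(m + e/2) + i (n + e/2)], up to the constant [e/2]. *)
Definition quad_norm (p : int * int) : nat :=
  absz (p.1 ^+ 2 + e%:Z * p.1 + (p.2 ^+ 2 + e%:Z * p.2)).

Lemma quad_ge (A B : nat) (j : int) : (B <= A)%N -> (0 < A)%N ->
  (`|j| <= (absz (A%:Z * j ^+ 2 + B%:Z * j)%R).+1)%N /\ 0 <= A%:Z * j ^+ 2 + B%:Z * j.
Proof. by case: j => n BA A0; rewrite ?NegzE; split; nia. Qed.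

Lemma quad_norm_box p : (quad_norm p < M)%N -> p \in box.
Proof.
case: p => m n; rewrite mem_box /quad_norm /=.
have [] := @quad_ge 1 e m e1 isT; have [] := @quad_ge 1 e n e1 isT.
by rewrite !mul1r => *; lia.
Qed.

Lemma quad_box A B A' B' d (x : int * int) :
  (B <= A)%N -> (0 < A)%N -> (B' <= A')%N -> (0 < A')%N ->
  (d + (absz (A%:Z * x.1 ^+ 2 + B%:Z * x.1)%R +
       absz (A'%:Z * x.2 ^+ 2 + B'%:Z * x.2)%R) < M)%N -> x \in box.
Proof.
move=> BA A0 BA' A0'; case: x => m n; rewrite mem_box /=.
by have [] := @quad_ge A B m BA A0; have [] := @quad_ge A' B' n BA' A0'; lia.
Qed.

(** Modulo 5 this is the image of [(m + e/2) + i (n + e/2)] under the morphism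
    to [Z/5Z] that sends [i] to 2; its kernel is generated by [2 - i]. *)
Definition residue (p : int * int) : int := p.1 + 2 * p.2 - e%:Z.

Definition coset_sum (r : int) : R :=
  \sum_(p <- box | ((residue p - r) %% 5)%Z == 0) q ^+ quad_norm p.

Lemma coset_sum_theta r d A B A' B' (h : int * int -> int * int) :
  (B <= A)%N -> (0 < A)%N -> (B' <= A')%N -> (0 < A')%N ->
  injective h -> (forall x, ((residue (h x) - r) %% 5)%Z == 0) ->
  (forall p, ((residue p - r) %% 5)%Z == 0 -> exists x, h x = p) ->
  (forall x, quad_norm (h x) = d + (absz (A%:Z * x.1 ^+ 2 + B%:Z * x.1)%R +
       absz (A'%:Z * x.2 ^+ 2 + B'%:Z * x.2)%R))%N ->
  coset_sum r = q ^+ d * (theta M q A B 1 * theta M q A' B' 1).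
Proof.
move=> BA A0 BA' A0' hI Ph hP hE.
rewrite theta_mul big_distrr /= /coset_sum.
rewrite (lattice_sum hI Ph hP hE quad_norm_box); last by move=> x; apply: quad_box.
by apply: eq_bigr => x _; rewrite !expr1n !mul1r -!exprD.
Qed.

(** The points of residue 0 are the multiples by [1 + 2 i] of the points of the
    lattice, and [1 + 2 i] has norm 5, so the same theta series reappears at
    [q^5]. *)
Lemma coset_sum0 : coset_sum 0 = q ^+ (2 * e) * theta M q 5 (5 * e) 1 ^+ 2.
Proof.
apply: (@coset_sum_theta _ _ _ _ _ _
  (fun x => (e%:Z + x.1 + 2 * x.2, 2 * x.1 - x.2))); try lia.
- by move=> [a b] [c d] [] *; congr (_, _); lia.
- by move=> [s t]; rewrite /residue /=; lia.
- move=> [m n]; rewrite /residue /= => h.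
  exists (((m + 2 * n - e%:Z) %/ 5)%Z, 2 * ((m + 2 * n - e%:Z) %/ 5)%Z - n).
  by rewrite /=; congr (_, _); lia.
move=> [s t] /=.
have [_ ] := @quad_ge 5 (5 * e) s ltac:(lia) isT.
have [_ ] := @quad_ge 5 (5 * e) t ltac:(lia) isT.
rewrite /quad_norm /=; move: e1; case: (e) => [|[|//]] _; nia.
Qed.

(** The rotation by a quarter turn about the centre of symmetry is multiplication
    by [i]: it preserves the norm and doubles the residue modulo 5.  As 2
    generates the units of [Z/5Z], it permutes the four remaining cosets
    cyclically and all of them give the same sum. *)
Lemma coset_sum_unit k : (k < 4)%N ->
  coset_sum ((1 - 2 * e%:Z) * 2 ^+ k) =
  q ^+ (1 - e) * (theta M q 5 (2 + e) 1 * theta M q 5 (4 - 3 * e) 1).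
Proof.
pose h0 (x : int * int) := (1 - e%:Z + x.1 + 2 * x.2, 2 * x.1 - x.2).
pose rot (x : int * int) := (- x.2 - e%:Z, x.1).
have hE x : quad_norm (h0 x) =
    (1 - e + (absz (5%:Z * x.1 ^+ 2 + (2 + e)%N%:Z * x.1)%R +
       absz (5%:Z * x.2 ^+ 2 + (4 - 3 * e)%N%:Z * x.2)%R))%N.
  case: x => s t.
  have [_ ] := @quad_ge 5 (2 + e) s ltac:(lia) isT.
  have [_ ] := @quad_ge 5 (4 - 3 * e) t ltac:(lia) isT.
  by rewrite /quad_norm /h0 /=; move: e1; case: (e) => [|[|//]] _; nia.
have rotE x : quad_norm (rot x) = quad_norm x.
  by rewrite /quad_norm /rot /=; congr absz; ring.
have rotI : injective rot.
  by move=> [a b] [c d] []; rewrite /rot /= => *; congr (_, _); lia.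
have h0I : injective h0.
  by move=> [a b] [c d] []; rewrite /h0 /= => *; congr (_, _); lia.
move=> k4; apply: (@coset_sum_theta _ _ _ _ _ _ (iter k rot \o h0)); try lia.
- by apply: inj_comp => //; elim: (k) => //= n IH; apply: inj_comp rotI IH.
- move=> [s t]; move: k4.
  by case: k => [|[|[|[|//]]]] _; rewrite /residue /h0 /rot /= ?exprS ?expr0;
    move: e1; case: (e) => [|[|//]] _; lia.
(* [back] undoes the rotation, [lift] inverts [h0] on its image *)
- move=> p hp; pose back (x : int * int) := (x.2, - x.1 - e%:Z).
  pose lift x := (((x.1 + 2 * x.2 - (1 - e%:Z)) %/ 5)%Z,
                  2 * ((x.1 + 2 * x.2 - (1 - e%:Z)) %/ 5)%Z - x.2).
  exists (lift (iter k back p)).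
  move: hp k4; rewrite /residue /lift; case: p => m n.
  by case: k => [|[|[|[|//]]]] hp _; move: hp;
    rewrite /h0 /rot /back /= ?exprS ?expr0; move: e1;
    case: (e) => [|[|//]] _ hp; congr (_, _); lia.
move=> x /=; rewrite -hE.
by elim: (k) => //= n IH; rewrite rotE.
Qed.

(** The square of the theta series is the sum over all five cosets, and those of
    nonzero residue contribute equally. *)
Lemma theta_sqr_split :
  theta M q 1 e 1 ^+ 2 = q ^+ (2 * e) * theta M q 5 (5 * e) 1 ^+ 2 +
    4 * (q ^+ (1 - e) * (theta M q 5 (2 + e) 1 * theta M q 5 (4 - 3 * e) 1)).
Proof.
rewrite -coset_sum0.
rewrite (_ : 4 * _ = \sum_(k < 4) coset_sum ((1 - 2 * e%:Z) * 2 ^+ k)); last first.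
  rewrite (eq_bigr _ (fun k _ => coset_sum_unit (ltn_ord k))).
  by rewrite sumr_const card_ord mulr_natl.
rewrite expr2 theta_mul !big_ord_recr big_ord0 /= add0r /coset_sum.
rewrite !(big_mkcond (fun p => _ == _)) -!big_split /=; apply: eq_bigr => -[m n] _.
rewrite !expr1n !mul1r -exprD.
rewrite (_ : (_ + _)%N = quad_norm (m, n)); last first.
  rewrite /quad_norm /=.
  have [_] := @quad_ge 1 e m e1 isT; have [_] := @quad_ge 1 e n e1 isT.
  by rewrite !mul1r; lia.
move: (residue _) (quad_norm _) e1 => d N.
have : (d %% 5)%Z = 0 \/ (d %% 5)%Z = 1 \/ (d %% 5)%Z = 2 \/
       (d %% 5)%Z = 3 \/ (d %% 5)%Z = 4 by lia.
move=> d5; case: (e) => [|[|//]] _.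
all: rewrite ?exprS ?expr0.
all: by case: d5 => [dE|[dE|[dE|[dE|dE]]]];
  do ![rewrite (_ : (_ == 0) = true) /=; last by lia
     | rewrite (_ : (_ == 0) = false) /=; last by lia];
  rewrite ?addr0 ?add0r.
Qed.

Lemma root_sum5 (z : R) n : z ^+ 5 = 1 -> \sum_(i < 5) z ^+ i = 0 ->
  \sum_(i < 5) (z ^+ n) ^+ i = if (5 %| n)%N then 5 else 0.
Proof.
move=> z5 z0; rewrite (expr5_mod (n := n %% 5) z5) ?modn_mod // /dvdn.
move: z0; rewrite !big_ord_recr !big_ord0 /= => z0.
have : (n %% 5 < 5)%N by rewrite ltn_mod.
case: (n %% 5)%N => [|[|[|[|[|//]]]]] _ /=.
- by rewrite !expr1n; ring.
- by rewrite expr1.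
all: rewrite -!exprM -[RHS]z0.
- rewrite (@expr5_mod _ z (2 * 3) 1) // (@expr5_mod _ z (2 * 4) 3) //=.
  rewrite expr1 !muln0 !muln1; ring.
- rewrite (@expr5_mod _ z (3 * 2) 1) // (@expr5_mod _ z (3 * 3) 4) //.
  rewrite (@expr5_mod _ z (3 * 4) 2) //= expr1 !muln0 !muln1; ring.
rewrite (@expr5_mod _ z (4 * 2) 3) // (@expr5_mod _ z (4 * 3) 2) //.
rewrite (@expr5_mod _ z (4 * 4) 1) //= expr1 !muln0 !muln1; ring.
Qed.

(** Orthogonality of characters: weighting the term of index [(m, n)] by
    [z^(i (m + 2 n - e))] and summing over [i] isolates the points of residue 0.
    The term [i = 0] is the square of the untwisted theta series. *)
Lemma theta_root_sum (z : R) : z ^+ 5 = 1 -> \sum_(i < 5) z ^+ i = 0 ->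
  \sum_(i < 5) z ^+ (4 * e * i) *
    (theta M q 1 e (z ^+ i) * theta M q 1 e (z ^+ (2 * i))) =
  5 * (q ^+ (2 * e) * theta M q 5 (5 * e) 1 ^+ 2).
Proof.
move=> z5 z0; rewrite -coset_sum0 /coset_sum big_distrr /= [RHS]big_mkcond /=.
under eq_bigr => i _ do rewrite theta_mul big_distrr /=.
rewrite exchange_big /=; apply: eq_bigr => -[m n] _ /=.
set a := absz (m %% 5)%Z; set b := absz (n %% 5)%Z.
rewrite -[q ^+ _ * _]exprD (_ : (_ + _)%N = quad_norm (m, n)); last first.
  rewrite /quad_norm /=.
  have [_] := @quad_ge 1 e m e1 isT; have [_] := @quad_ge 1 e n e1 isT.
  by rewrite !mul1r; lia.
transitivity ((\sum_(i < 5) (z ^+ (4 * e + a + 2 * b)) ^+ i) * q ^+ quad_norm (m, n)).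
  rewrite mulr_suml; apply: eq_bigr => i _; rewrite mulrA; congr (_ * _).
  by rewrite -!exprM -!exprD; congr (_ ^+ _); lia.
rewrite root_sum5 // /residue /= /a /b.
case: ifP => h; case: ifP => // h'; rewrite ?mul0r //; exfalso; lia.
Qed.
End Lattice.

(** * The cubic equation *)

Section Cubic.
Variables (R : comUnitRingType) (M : nat) (z : R).
Hypotheses (z5 : z ^+ 5 = 1) (z0 : \sum_(i < 5) z ^+ i = 0).
Implicit Types q c : R.

Local Notation progprod := (progprod M).
Local Notation theta := (theta M).
Local Notation odd_prod := (odd_prod M).
Local Notation even_prod := (even_prod M).

(** Grouping conjugate roots, [c = z + z^4] and [d = z^2 + z^3] satisfy
    [c + d = c d = - 1]. *)
Lemma prod_roots x :
  (1 + x) * ((1 + z * x) * (1 + z ^+ 2 * x) * (1 + z ^+ 3 * x) * (1 + z ^+ 4 * x))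
  = 1 + x ^+ 5.
Proof.
have s0 : 1 + z + z ^+ 2 + z ^+ 3 + z ^+ 4 = 0.
  by rewrite -z0 !big_ord_recr big_ord0 /= add0r.
pose c := z + z ^+ 4; pose d := z ^+ 2 + z ^+ 3.
have cd : c + d = -1 by rewrite -[RHS]addr0 -s0 /c /d; ring.
have cd' : c * d = -1.
  have -> : c * d = z ^+ 3 + z ^+ 4 + z ^+ 5 * z + z ^+ 5 * z ^+ 2 by rewrite /c /d; ring.
  by rewrite z5 -[RHS]addr0 -s0; ring.
transitivity ((1 + x) * ((1 + c * x + z ^+ 5 * x ^+ 2) * (1 + d * x + z ^+ 5 * x ^+ 2))).
  by rewrite /c /d; ring.
rewrite z5; transitivity ((1 + x) * (1 + (c + d) * x + (2 + c * d) * x ^+ 2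
                                     + (c + d) * x ^+ 3 + x ^+ 4)).
  by ring.
by rewrite cd cd'; ring.
Qed.

Definition root_prod q d r :=
  progprod q d r z * progprod q d r (z ^+ 2) *
  progprod q d r (z ^+ 3) * progprod q d r (z ^+ 4).

Lemma progprod_roots q d r :
  progprod q d r 1 * root_prod q d r = progprod q (5 * d) (5 * r) 1.
Proof.
rewrite /root_prod /progprod -!big_split /=; apply: eq_bigr => i _.
rewrite !mul1r prod_roots -exprM; congr (1 + _ ^+ _); lia.
Qed.

Lemma expr5_root k : (z ^+ k) ^+ 5 = 1.
Proof. by rewrite -exprM mulnC exprM z5 expr1n. Qed.

(** The case [e = 0] of the two theta identities.  With [p = progprod q 2 1 1] and
    [E = progprod q 2 2 (-1)], whose values at [q^5] are [p'] and [E'], they read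
      [p^4 E^2 - p'^4 E'^2 = 4 q u E'^2] and
      [5 p'^4 E'^2 - p^4 E^2 = 4 E^2 / u],
    where [p = u p'] and [E^2 = b E'^2].  Eliminating [p'] gives the conclusion,
    which becomes the cubic for [T = q u^2] once multiplied by [q^2]. *)
Lemma odd_cubic q : q ^+ M = 0 ->
  let u := odd_prod q 1 in let b := even_prod q (-1) ^+ 2 in
  b * (b * u ^+ 4 - 1) = q * u ^+ 2 * (5 - b * u ^+ 4).
Proof.
move=> qM u b.
set X := root_prod q 2 1.
set p' := progprod q 10 5 1; set E' := progprod q 10 10 (-1).
have p'U : p' \is a GRing.unit by apply: progprod_unit.
have E'U : E' \is a GRing.unit by apply: progprod_unit.
have pE : progprod q 2 1 1 = u * p' by rewrite progprod_odd.
have EE : progprod q 2 2 (-1) = even_prod q (-1) * E' by rewrite progprod_even.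
have uX : u * X = 1.
  apply: (mulIr p'U); rewrite mul1r -[RHS](progprod_roots q 2 1) pE -/X; ring.
have th k : theta q 1 0 (z ^+ k) =
    progprod q 2 1 (z ^+ k) * progprod q 2 1 (z ^+ ((4 * k) %% 5)) *
    (even_prod q (-1) * E').
  by rewrite theta_product ?expr5_root // -exprM mulnC -(expr_mod (4 * k) z5) EE.
have th0 : theta q 1 0 1 = (u * p') ^+ 2 * (even_prod q (-1) * E').
  by rewrite theta_product ?expr1n // pE EE expr2.
have th5 : theta q 5 0 1 = p' ^+ 2 * E' by rewrite theta_product ?expr1n // expr2.
have L1 := @theta_sqr_split R M q qM 0 isT.
have L2 := @theta_root_sum R M q qM 0 isT z z5 z0.
move: L1 L2; rewrite !muln0 subn0 !expr0 !expr1 !mul1r addn0 th5 th0.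
rewrite (@theta_product _ _ _ 5 2) ?expr1n // (@theta_product _ _ _ 5 4) ?expr1n //=.
move=> L1.
rewrite !big_ord_recr big_ord0 /= !mul0n !expr0 !mul1r !add0r th0 !th /= -/E'.
(* every twisted term is the product of the same four factors *)
pose A k := progprod q 2 1 (z ^+ k); pose F := even_prod q (-1) * E'.
rewrite -[LHS]/(((u * p') ^+ 2 * F) * ((u * p') ^+ 2 * F)
  + (A 1 * A 4 * F) * (A 2 * A 3 * F) + (A 2 * A 3 * F) * (A 4 * A 1 * F)
  + (A 3 * A 2 * F) * (A 6 * A 4 * F) + (A 4 * A 1 * F) * (A 8 * A 2 * F)).
have -> : A 6 = A 1 by rewrite /A (expr5_mod (n := 1) z5).
have -> : A 8 = A 3 by rewrite /A (expr5_mod (n := 3) z5).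
move=> L2.
rewrite -/E' in L1.
have e1 : p' ^+ 4 * (b * u ^+ 4 - 1) = 4 * q * u.
  apply: (mulIr E'U); apply: (mulIr E'U).
  transitivity (((u * p') ^+ 2 * (even_prod q (-1) * E')) ^+ 2 - (p' ^+ 2 * E') ^+ 2).
    by rewrite /b; ring.
  by rewrite L1 /u /odd_prod; ring.
have e2 : p' ^+ 4 * (5 - b * u ^+ 4) = 4 * b * X.
  apply: (mulIr E'U); apply: (mulIr E'U).
  transitivity (5 * (p' ^+ 2 * E') ^+ 2
                - ((u * p') ^+ 2 * (even_prod q (-1) * E')) ^+ 2).
    by rewrite /b; ring.
  by rewrite -L2 /X /root_prod /b /F /A !expr1; ring.
apply: (mulrI (unitrX 4 p'U)).
rewrite [LHS]mulrCA e1 [RHS]mulrCA e2.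
transitivity (4 * q * b * u * (u * X)); last by ring.
by rewrite uX; ring.
Qed.

(** The case [e = 1], where the theta series is twice the product
    [s^2 E] with [s = progprod q 2 2 1]; the factor 4 in its square has to be
    cancelled.  The conclusion is the cubic for [T = - w^2]. *)
Lemma even_cubic q : q ^+ M = 0 -> (2 : R) \is a GRing.unit ->
  let w := even_prod q 1 in let b := even_prod q (-1) ^+ 2 in
  b * (b * w ^+ 4 - q ^+ 2) = w ^+ 2 * (b * w ^+ 4 - 5 * q ^+ 2).
Proof.
move=> qM two w b.
set X := root_prod q 2 2.
set s' := progprod q 10 10 1; set E' := progprod q 10 10 (-1).
have s'U : s' \is a GRing.unit by apply: progprod_unit.
have E'U : E' \is a GRing.unit by apply: progprod_unit.
have sE : progprod q 2 2 1 = w * s' by rewrite progprod_even.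
have EE : progprod q 2 2 (-1) = even_prod q (-1) * E' by rewrite progprod_even.
have wX : w * X = 1.
  apply: (mulIr s'U); rewrite mul1r -[RHS](progprod_roots q 2 2) sE -/X; ring.
have th k : theta q 1 1 (z ^+ k) = (1 + z ^+ ((4 * k) %% 5)) *
    (progprod q 2 2 (z ^+ k) * progprod q 2 2 (z ^+ ((4 * k) %% 5)) *
     (even_prod q (-1) * E')).
  rewrite theta_product ?expr5_root // -exprM mulnC -(expr_mod (4 * k) z5) EE.
  rewrite (@progprod_shift _ _ q 2) //; ring.
have th0 : theta q 1 1 1 = 2 * ((w * s') ^+ 2 * (even_prod q (-1) * E')).
  by rewrite theta_product ?expr1n // EE (@progprod_shift _ _ q 2) // sE; ring.
have th5 : theta q 5 5 1 = 2 * (s' ^+ 2 * E').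
  rewrite theta_product ?expr1n // -[LHS]/(s' * progprod q 10 0 1 * E').
  rewrite progprod_shift //.
  by rewrite -/s'; ring.
have L1 := @theta_sqr_split R M q qM 1 isT.
have L2 := @theta_root_sum R M q qM 1 isT z z5 z0.
move: L1 L2; rewrite !muln1 subnn !expr0 !mul1r th5 th0.
rewrite (@theta_product _ _ _ 5 3) ?expr1n // (@theta_product _ _ _ 5 1) ?expr1n //=.
move=> L1.
rewrite !big_ord_recr big_ord0 /= !expr0 !mul1r !add0r th0 !th /= -/E'.
pose A k := progprod q 2 2 (z ^+ k); pose F := even_prod q (-1) * E'.
pose G k l := (1 + z ^+ l) * (A k * A l * F).
rewrite -[LHS]/(2 * ((w * s') ^+ 2 * F) * (2 * ((w * s') ^+ 2 * F))
  + z ^+ 4 * (G 1 4 * G 2 3) + z ^+ 8 * (G 2 3 * G 4 1)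
  + z ^+ 12 * (G 3 2 * G 6 4) + z ^+ 16 * (G 4 1 * G 8 2)).
have -> : G 6 4 = G 1 4 by rewrite /G /A (expr5_mod (m := 6) (n := 1) z5).
have -> : G 8 2 = G 3 2 by rewrite /G /A (expr5_mod (m := 8) (n := 3) z5).
rewrite -/E' in L1 => L2.
have four : (4 : R) \is a GRing.unit.
  by rewrite (_ : 4 = 2 * 2) ?unitrM ?two //; ring.
have e1 : s' ^+ 4 * (b * w ^+ 4 - q ^+ 2) = w.
  apply: (mulrI four); apply: (mulIr E'U); apply: (mulIr E'U).
  transitivity ((2 * ((w * s') ^+ 2 * (even_prod q (-1) * E'))) ^+ 2
                - q ^+ 2 * (2 * (s' ^+ 2 * E')) ^+ 2).
    by rewrite /b; ring.
  by rewrite L1 /w /even_prod; ring.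
have s0 : z + z ^+ 2 + z ^+ 3 + z ^+ 4 = -1.
  by rewrite -[RHS]addr0 -z0 !big_ord_recr big_ord0 /=; ring.
have e2 : s' ^+ 4 * (b * w ^+ 4 - 5 * q ^+ 2) = b * X.
  apply: (mulrI four); apply: (mulIr E'U); apply: (mulIr E'U).
  transitivity ((2 * ((w * s') ^+ 2 * (even_prod q (-1) * E'))) ^+ 2
                - 5 * (q ^+ 2 * (2 * (s' ^+ 2 * E')) ^+ 2)).
    by rewrite /b; ring.
  have {}L2 : 4 * ((w * s') ^+ 2 * F) ^+ 2 - 4 * (b * X) * E' ^+ 2 =
      5 * (q ^+ 2 * (2 * (s' ^+ 2 * E')) ^+ 2).
    rewrite -L2 /G (expr5_mod (n := 3) z5 (m := 8)) //.
    rewrite (expr5_mod (n := 2) z5 (m := 12)) // (expr5_mod (n := 1) z5 (m := 16)) //.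
    (* the weights [z^i] and the factors [1 + z^i] expand to this sum, which is
       [4 (z + z^2 + z^3 + z^4) = - 4] *)
    transitivity (4 * ((w * s') ^+ 2 * F) ^+ 2 +
       (z + 2 * z ^+ 2 + 2 * z ^+ 3 + 4 * z ^+ 4 + 2 * z ^+ 5 * (z + z ^+ 2 + z ^+ 3)
        + z ^+ 5 * z ^+ 5 * z) * (b * X) * E' ^+ 2).
      rewrite z5 -[- _]mulN1r -[- 1](s0); ring.
    by rewrite /b /X /root_prod /F /A !expr1; ring.
  by rewrite -L2 /F; ring.
apply: (mulrI (unitrX 4 s'U)).
rewrite [LHS]mulrCA e1 [RHS]mulrCA e2.
transitivity (b * w * (w * X)); first by rewrite wX; ring.
by ring.
Qed.
End Cubic.

(** Vieta and Newton for the three roots of a cubic, by divided differences.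
    Since [U] and [V] agree modulo [q], dividing by [U - V] costs a factor [q],
    which stays in the conclusion as [q] is not cancellable. *)
Lemma cubic_power_sum (R : comUnitRingType) (q b d U V W : R) :
  let c T := b * T ^+ 3 + b ^+ 2 * T ^+ 2 - 5 * q ^+ 2 * T - b * q ^+ 2 in
  c U = 0 -> c V = 0 -> c W = 0 ->
  b \is a GRing.unit -> U - W \is a GRing.unit -> V - W \is a GRing.unit ->
  d \is a GRing.unit -> U - V = q * d ->
  q * (U ^+ 3 + V ^+ 3 + W ^+ 3 + b ^+ 3 + 12 * q ^+ 2) = 0.
Proof.
move=> c cU cV cW ub uUW uVW ud UV.
pose D T := b * (T ^+ 2 + T * W + W ^+ 2) + b ^+ 2 * (T + W) - 5 * q ^+ 2.
have DU : D U = 0.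
  apply: (mulrI uUW); transitivity (c U - c W); first by rewrite /D /c; ring.
  by rewrite cU cW subrr mulr0.
have DV : D V = 0.
  apply: (mulrI uVW); transitivity (c V - c W); first by rewrite /D /c; ring.
  by rewrite cV cW subrr mulr0.
(* second divided difference: the sum of the roots *)
have e1 : q * (U + V + W + b) = 0.
  apply: (mulrI ud); apply: (mulrI ub).
  transitivity (q * d * (b * (U + V + W + b))); first by ring.
  transitivity (D U - D V); last by rewrite DU DV subrr !mulr0.
  by rewrite -UV /D; ring.
apply: (mulrI ub); rewrite mulr0.
transitivity (q * (c U + c V + c W) - 2 * b * q * D U
   + (5 * q ^+ 2 - b ^+ 2 * (V - b - U - W)) * (q * (U + V + W + b))).
  by rewrite /c /D; ring.
by rewrite cU cV cW DU e1; ring.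
Qed.

(** * The identity between the four products *)

Section Identity.
Variables (R : comUnitRingType) (M : nat) (z q : R).
Hypotheses (z5 : z ^+ 5 = 1) (z0 : \sum_(i < 5) z ^+ i = 0).
Hypotheses (qM : q ^+ M = 0) (two : (2 : R) \is a GRing.unit).

Local Notation progprod := (progprod M).
Local Notation odd_prod := (odd_prod M).
Local Notation even_prod := (even_prod M).

Definition onemod (x : R) := exists y, x = 1 + q * y.

Lemma onemodM x y : onemod x -> onemod y -> onemod (x * y).
Proof. by case=> a -> [b ->]; exists (a + b + q * a * b); ring. Qed.

Lemma onemodX x n : onemod x -> onemod (x ^+ n).
Proof.
move=> hx; elim: n => [|n IH]; first by exists 0; rewrite mulr0 addr0.
by rewrite exprS; apply: onemodM.
Qed.

Lemma onemod_unit x : onemod x -> x \is a GRing.unit.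
Proof. by case=> y ->; apply: (@unit_1Dnil _ _ M); rewrite exprMn qM mul0r. Qed.

Lemma onemod_progprod d r c : (0 < r)%N -> onemod (progprod q d r c).
Proof.
move=> r0; rewrite /progprod; elim/big_ind: _.
- by exists 0; rewrite mulr0 addr0.
- exact: onemodM.
move=> i _; exists (c * q ^+ (d * i + r).-1).
by rewrite mulrCA -exprS prednK //; lia.
Qed.

Lemma progprod_opp_even d r c : ~~ odd d -> ~~ odd r ->
  progprod (- q) d r c = progprod q d r c.
Proof.
move=> d2 r2; apply: eq_bigr => i _.
by rewrite exprNn -signr_odd oddD oddM (negPf d2) (negPf r2) mul1r.
Qed.

Lemma progprod_opp_odd d r c : ~~ odd d -> odd r ->
  progprod (- q) d r c = progprod q d r (- c).
Proof.
move=> d2 r2; apply: eq_bigr => i _.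
by rewrite exprNn -signr_odd oddD oddM (negPf d2) r2 /= expr1 mulN1r mulrN mulNr.
Qed.

Lemma eta_identity :
  q * (even_prod q 1 ^+ 6 - even_prod q (-1) ^+ 6
       - q ^+ 3 * (odd_prod q 1 ^+ 6 - odd_prod q (-1) ^+ 6) - 12 * q ^+ 2) = 0.
Proof.
set w := even_prod q 1; set u := odd_prod q 1; set v := odd_prod q (-1).
pose b := even_prod q (-1) ^+ 2.
have odd1 c : onemod (odd_prod q c).
  by do !apply: onemodM; apply: onemod_progprod.
have even1 c : onemod (even_prod q c).
  by do !apply: onemodM; apply: onemod_progprod.
have cu := odd_cubic z5 z0 qM; have cw := even_cubic z5 z0 qM two.
have cv : b * (b * v ^+ 4 - 1) = - q * v ^+ 2 * (5 - b * v ^+ 4).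
  have qM' : (- q) ^+ M = 0 by rewrite exprNn qM mulr0.
  have ov : odd_prod (- q) 1 = v by rewrite /odd_prod !progprod_opp_odd.
  have ob : even_prod (- q) (-1) = even_prod q (-1).
    by rewrite /even_prod !progprod_opp_even.
  by have := odd_cubic z5 z0 qM'; rewrite /= ov ob.
rewrite /= -/u -/b -/w in cu cw.
have ub : b \is a GRing.unit by apply: onemod_unit; apply: onemodX.
have [y2 v2] : onemod (v ^+ 2) := onemodX 2 (odd1 _).
have [x2 u2] : onemod (u ^+ 2) := onemodX 2 (odd1 _).
have [t2 w2] : onemod (w ^+ 2) := onemodX 2 (even1 _).
have /unitrPr[h two1] := two.
have d1 : u ^+ 2 + v ^+ 2 \is a GRing.unit.
  rewrite (_ : _ + _ = 2 * (1 + q * (h * (x2 + y2)))).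
    by rewrite unitrM two; apply: onemod_unit; eexists.
  transitivity (2 + q * ((2 * h) * (x2 + y2))); last by ring.
  by rewrite two1 u2 v2; ring.
have := @cubic_power_sum R q b (u ^+ 2 + v ^+ 2)
  (q * u ^+ 2) (- q * v ^+ 2) (- w ^+ 2).
move=> /(_ _ _ _ ub _ _ d1) H.
rewrite -[RHS]oppr0 -H.
- by rewrite /b; ring.
- transitivity (q ^+ 2 *
    (b * (b * u ^+ 4 - 1) - q * u ^+ 2 * (5 - b * u ^+ 4))); first by ring.
  by rewrite cu; ring.
- transitivity (q ^+ 2 *
    (b * (b * v ^+ 4 - 1) - - q * v ^+ 2 * (5 - b * v ^+ 4))); first by ring.
  by rewrite cv; ring.
- transitivity (b * (b * w ^+ 4 - q ^+ 2)
    - w ^+ 2 * (b * w ^+ 4 - 5 * q ^+ 2)); first by ring.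
  by rewrite cw; ring.
- by apply: onemod_unit; exists (u ^+ 2 + t2); rewrite w2; ring.
- by apply: onemod_unit; exists (- v ^+ 2 + t2); rewrite w2; ring.
by ring.
Qed.
End Identity.

(** * Generating functions of colored partitions *)

Section Counting.
Variables (P : pred nat) (X : set colored_int) (N K : nat).
Hypothesis XP : forall x, X x <-> P (value x).
Hypothesis NK : (N < K)%N.

Definition odd_index_sets : {set {set 'I_K * 'I_6}} :=
  [set J : {set 'I_K * 'I_6} |
    [&& [forall i in J, P i.1], (\sum_(i in J) i.1)%N == N & odd #|J|]].

Let g (i : 'I_K * 'I_6) : colored_int := (val i.1, i.2).

Lemma odd_partition_count_index : odd_partition_count X N = #|odd_index_sets|.
Proof.
have gI : injective g by move=> [a b] [c d] [/val_inj-> ->].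
pose G (J : {set 'I_K * 'I_6}) : {fset colored_int} := [fset g i | i in J]%fset.
have memG J i : (g i \in G J) = (i \in J).
  apply/imfsetP/idP => [[j /= jJ /gI ->] //|iJ]; by exists i.
have GI : injective G by move=> J J' /fsetP e; apply/setP => i; rewrite -!memG.
have cardG J : #|` G J| = #|J| by rewrite card_imfset //= cardE.
have sumG J : (\sum_(x <- G J) value x = \sum_(i in J) i.1)%N.
  by rewrite big_imfset /=; [rewrite big_enum | move=> ? ? _ _; apply: gI].
rewrite /odd_partition_count.
have -> : fset_set (odd_distinct_partitions X N) =
          [fset G J | J in odd_index_sets]%fset.
  apply/fsetP => A.
  rewrite in_fset_set; last exact: finite_odd_distinct_partitions.
  apply/idP/imfsetP => [|[J /=]].
    rewrite inE => -[[AX sumA] oddA].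
    have AN x : x \in A -> (value x < K)%N.
      by move=> xA; apply: leq_ltn_trans NK; rewrite -sumA (big_fsetD1 x) //= leq_addr.
    have AE : A = G [set i | g i \in A]%SET.
      apply/fsetP => x.
      apply/idP/imfsetP => [xA|[i /=]]; last by rewrite inE => ? ->.
      by exists (Ordinal (AN x xA), x.2); rewrite /= ?inE /g /=; case: (x) xA.
    exists [set i | g i \in A]%SET => //=.
    rewrite inE -cardG -sumG -AE oddA sumA eqxx !andbT.
    by apply/forall_inP => i; rewrite inE => /AX /XP.
  rewrite !inE => /and3P[/forall_inP JP /eqP sJ oJ] ->.
  split; last by rewrite cardG.
  split; last by rewrite sumG.
  by move=> x /imfsetP[i /= iJ ->]; apply/XP/JP.
by rewrite card_imfset //= cardE.
Qed.

Definition colored_gf (F : fieldType) (c : F) : {poly F} :=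
  \prod_(k < K) (if P k then (1 + c *: 'X^k) ^+ 6 else 1).

(** Expanding the product over all colored integers below [K] gives one term for
    each set of colored integers. *)
Lemma coef_colored_gf (F : fieldType) (c : F) :
  (colored_gf c)`_N = \sum_(J : {set 'I_K * 'I_6} |
     [forall i in J, P i.1] && ((\sum_(i in J) i.1)%N == N)) c ^+ #|J|.
Proof.
transitivity ((\prod_(i : 'I_K * 'I_6)
  ((if P i.1 then c *: 'X^(i.1) else 0) + 1))`_N : F).
  congr (_`_N); rewrite /colored_gf.
  under eq_bigr => k _.
    rewrite (_ : (if _ then _ else _) =
      \prod_(j < 6) ((if P k then c *: 'X^k else 0) + 1)); last first.
      rewrite prodr_const card_ord; case: ifP => _; first by rewrite addrC.
      by rewrite add0r expr1n.
    over.
  by rewrite pair_bigA.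
rewrite bigA_distr coef_sum [RHS]big_mkcond /=; apply: eq_bigr => J _.
rewrite -big_mkcond /=; case: forall_inP => [JP|nJP] /=; last first.
  have [i iJ nP] : exists2 i, i \in J & ~~ P i.1.
    apply/exists_inP; rewrite -[X in is_true X]negbK negb_exists_in.
    by apply/forall_inP => h; apply: nJP => i iJ; have := h i iJ; rewrite negbK.
  by rewrite (bigD1 i) //= (negPf nP) mul0r coef0.
rewrite (eq_bigr (fun i : 'I_K * 'I_6 => c *: 'X^(i.1))); last by move=> i /JP ->.
rewrite scaler_prod prodr_const -expr_sum coefZ coefXn eq_sym.
by case: eqP => _; rewrite ?mulr1 ?mulr0.
Qed.

Lemma coef_colored_gf_odd (F : fieldType) :
  (colored_gf (1 : F) - colored_gf (-1))`_N = 2 * (odd_partition_count X N)%:R.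
Proof.
rewrite coefB !coef_colored_gf -sumrB odd_partition_count_index.
rewrite -sum1_card natr_sum big_distrr /=.
rewrite [RHS]big_mkcond [LHS]big_mkcond /=; apply: eq_bigr => J _.
rewrite inE; case: [forall i in J, P i.1]; case: (_ == N) => //=.
rewrite expr1n -signr_odd; case: (odd _); rewrite ?expr0 ?expr1 ?subrr //; ring.
Qed.
End Counting.

Definition S_value (k : nat) : bool := [&& (0 < k)%N, ~~ odd k & ~~ (5 %| k)%N].
Definition T_value (k : nat) : bool := [&& (0 < k)%N, odd k & ~~ (5 %| k)%N].

Lemma S_parts_value x : S_parts x <-> S_value (value x).
Proof. by split=> [[] *|/and3P[]] //; apply/and3P. Qed.

Lemma T_parts_value x : T_parts x <-> T_value (value x).
Proof. by split=> [[] *|/and3P[]] //; apply/and3P. Qed.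

Lemma odd_prodE (R : comNzRingType) M (q c : R) : q ^+ M = 0 ->
  odd_prod M q c = \prod_(k < M) (if T_value k then 1 + c * q ^+ k else 1).
Proof.
move=> qM; rewrite /odd_prod !progprod_split // -!big_split /=.
by apply: eq_bigr => k _; rewrite /T_value; by_residue_mod10 (k : nat).
Qed.

Lemma even_prodE (R : comNzRingType) M (q c : R) : q ^+ M = 0 ->
  even_prod M q c = \prod_(k < M) (if S_value k then 1 + c * q ^+ k else 1).
Proof.
move=> qM; rewrite /even_prod !progprod_split // -!big_split /=.
by apply: eq_bigr => k _; rewrite /S_value; by_residue_mod10 (k : nat).
Qed.

Lemma in_qpoly_Xn_coef (F : fieldType) n (p : {poly F}) i :
  in_qpoly 'X^(n.+1) p = 0 -> (i < n.+1)%N -> p`_i = 0.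
Proof.
move=> /(congr1 val) /= p0 i_n.
have := @Pdiv.RingMonic.rdivp_eq _ _ (monicXn F n.+1) p.
by rewrite mk_monic_Xn /= in p0; rewrite p0 addr0 => ->; rewrite coefMXn i_n.
Qed.

Lemma in_qpoly_colored_gf (F : fieldType) (h : {poly F}) P M (c : F) :
  in_qpoly h (colored_gf P M c) =
  (\prod_(k < M)
     (if P k then 1 + in_qpoly h c%:P * in_qpoly h 'X ^+ k else 1)) ^+ 6.
Proof.
rewrite rmorph_prod -prodrXl; apply: eq_bigr => k _.
case: ifP => _; last by rewrite rmorph1 expr1n.
by rewrite rmorphXn rmorphD rmorph1 -mul_polyC rmorphM rmorphXn.
Qed.

(** [eta_identity] in the ring of polynomials modulo [X^(M+1)].  Its factor [q]
    costs one degree of precision. *)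
Lemma colored_gf_identity M n : (n.+1 < M.+1)%N ->
  (colored_gf S_value M.+1 (1 : algC) - colored_gf S_value M.+1 (-1)
   - 'X^3 * (colored_gf T_value M.+1 1 - colored_gf T_value M.+1 (-1))
   - 12 * 'X^2)`_n = 0.
Proof.
move=> nM; set p := _ - _.
have -> : p`_n = ('X * p)`_n.+1 by rewrite coefXM.
apply: in_qpoly_Xn_coef nM.
pose pi : {rmorphism {poly algC} -> {poly %/ ('X^(M.+1) : {poly algC})}} :=
  in_qpoly 'X^(M.+1).
have [zeta zP] := @C_prim_root_exists 5 isT.
have z5 : zeta ^+ 5 = 1 := prim_expr_order zP.
have z0 : \sum_(i < 5) zeta ^+ i = 0.
  apply/eqP; have := subrX1 zeta 5; rewrite z5 subrr => /esym/eqP.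
  rewrite mulf_eq0 subr_eq0 => /orP[/eqP z1|//].
  by have := prim_order_dvd zP 1; rewrite z1 expr1 eqxx.
have qM : pi 'X ^+ M.+1 = 0.
  rewrite -(rmorphXn pi); apply: val_inj => /=.
  by rewrite mk_monic_Xn /= Pdiv.RingMonic.rmodpp ?monicXn.
have two : (2 : {poly %/ ('X^(M.+1) : {poly algC})}) \is a GRing.unit.
  apply/unitrPr; exists (pi (2^-1)%:P); rewrite -(rmorph_nat pi 2) -rmorphM.
  by rewrite -polyC_natr -polyCM mulfV ?rmorph1 // pnatr_eq0.
have Z5 : pi zeta%:P ^+ 5 = 1 by rewrite -rmorphXn -polyC_exp z5 !rmorph1.
have Z0 : \sum_(i < 5) pi zeta%:P ^+ i = 0.
  rewrite -[RHS](rmorph0 pi) -[0 in RHS](rmorph0 (@polyC algC)) -z0 !rmorph_sum.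
  by apply: eq_bigr => i _; rewrite !rmorphXn.
have := eta_identity Z5 Z0 qM two.
rewrite !odd_prodE // !even_prodE //.
have pi1 : pi 1%:P = 1 by rewrite polyC1 rmorph1.
have piN1 : pi (-1)%:P = -1 by rewrite polyCN rmorphN pi1.
have piE P c : pi (colored_gf P M.+1 c) = _ := in_qpoly_colored_gf _ P M.+1 c.
move=> H; rewrite -[RHS]H /p -[LHS]/(pi _) rmorphM !rmorphB rmorphM rmorphXn rmorphB.
by rewrite rmorphM rmorphXn rmorph_nat !piE pi1 piN1.
Qed.

Local Close Scope ring_scope.
Local Open Scope nat_scope.

Theorem theorem3p21 (N : nat) (hN : 4 <= N) : D_S N = D_T (N - 3).
Proof.
have := @colored_gf_identity N.+1 N (ltnSn _).
rewrite coefB coefB (mulrC 'X^3%R) !coefMXn -polyC_natr coefC.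
rewrite (_ : (N < 3) = false) 1?(_ : (N < 2) = false) 1?(_ : (N - 2 == 0) = false);
  try lia.
rewrite subr0 (coef_colored_gf_odd S_parts_value); last by lia.
rewrite (coef_colored_gf_odd T_parts_value); last by lia.
rewrite -mulrBr => /eqP; rewrite mulf_eq0 pnatr_eq0 /= subr_eq0 eqr_nat.
by move/eqP.
Qed.
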